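(* Let $V$ be a vector space over a field $k$ and let $\varphi\in\mathrm{End}_k(V)$ be a finite potent endomorphism with AST decomposition $V=W_\varphi\oplus U_\varphi$. Then an endomorphism $\phi\in\mathrm{End}_k(V)$ is a 1GD inverse of $\varphi$ if and only if $\phi\in X_\varphi(1,2)$ and $\phi(U_\varphi)\subseteq U_\varphi$.
   Context: $k$ is an arbitrary field, $V$ an arbitrary (possibly infinite-dimensional) $k$-vector space. An endomorphism $\varphi\in\mathrm{End}_k(V)$ is finite potent if $\varphi^n(V)$ is finite dimensional for some $n\ge 1$. For such $\varphi$ there is a unique $\varphi$-invariant decomposition $V=W_\varphi\oplus U_\varphi$ (the AST decomposition) with $W_\varphi$ finite dimensional, $\varphi|_{W_\varphi}$ an automorphism of $W_\varphi$, and $\varphi|_{U_\varphi}$ nilpotent; the index $i(\varphi)$ is the nilpotency order of $\varphi|_{U_\varphi}$ ($i(\varphi)=0$ iff $V$ is finite dimensional and $\varphi$ is an automorphism). Put $m=i(\varphi)$. A $\{1\}$-inverse of $\varphi$ is $\varphi^-\in\mathrm{End}_k(V)$ with $\varphi\varphi^-\varphi=\varphi$; the set of them is $X_\varphi(1)$. $X_\varphi(1,2)$ is the set of reflexive generalized inverses, i.e. $\psi\in\mathrm{End}_k(V)$ with $\varphi\psi\varphi=\varphi$ and $\psi\varphi\psi=\psi$. A G-Drazin inverse of $\varphi$ is $\varphi^{GD}\in\mathrm{End}_k(V)$ with $\varphi\varphi^{GD}\varphi=\varphi$ and $\varphi^{GD}\varphi^m=\varphi^m\varphi^{GD}$; the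 set of them is $X_\varphi(GD)$. A 1GD inverse of $\varphi$ is $\psi\in\mathrm{End}_k(V)$ such that $\psi\varphi\psi=\psi$, $\psi\varphi=\varphi^{-}\varphi$ and $\varphi\psi=\varphi\varphi^{GD}$ for some $\varphi^-\in X_\varphi(1)$ and $\varphi^{GD}\in X_\varphi(GD)$. *)

(* Defs.v *)
From HB Require Import structures.
From mathcomp Require Import all_boot all_order all_algebra.
From mathcomp Require Import boolp classical_sets functions.

Set Implicit Arguments.
Unset Strict Implicit.
Unset Printing Implicit Defensive.

Import GRing.Theory.
Local Open Scope classical_set_scope.
Local Open Scope ring_scope.

Section Definitions.
Variables (k : fieldType) (V : lmodType k).
Implicit Types (phi psi g : {linear V -> V}) (S W U : set V) (n m : nat).

Definition subspace S : Prop := GRing.submod_closed [in S].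

Definition lspan n (e : 'I_n -> V) : set V :=
  [set v | exists c : 'rV[k]_n, v = \sum_i c 0 i *: e i].

Definition finite_dimensional S : Prop :=
  exists n (e : 'I_n -> V), S = lspan e.

Definition finite_potent phi : Prop :=
  exists2 n, (0 < n)%N & finite_dimensional (range (iter n phi)).

Definition invariant_subspace phi S : Prop :=
  subspace S /\ phi @` S `<=` S.

Definition direct_decomposition W U : Prop :=
  W `&` U = [set 0] /\ forall v, exists w u, [/\ W w, U u & v = w + u].

Definition vanishes_on (f : V -> V) S : Prop := forall v, S v -> f v = 0.

(* The subspaces W, U carry the AST decomposition V = W_phi (+) U_phi;
   [AST_exists] and [AST_unique] below show that they exist and are unique. *)
Definition AST_decomposition phi W U : Prop :=
  [/\ invariant_subspace phi W, invariant_subspace phi U,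
      direct_decomposition W U,
      finite_dimensional W /\ set_bij W W phi
    & exists n, vanishes_on (iter n phi) U].

(* Here n = 0 is allowed: iter 0 phi is the identity, so the order is 0
   exactly when S is the zero subspace. *)
Definition nilpotency_order phi S m : Prop :=
  vanishes_on (iter m phi) S
  /\ forall n, vanishes_on (iter n phi) S -> (m <= n)%N.

(* i(phi); the value 0 is a dummy when phi is not finite potent, see
   [fp_indexP] for the finite potent case. *)
Definition fp_index phi : nat :=
  xget 0%N [set m | exists W U,
    AST_decomposition phi W U /\ nilpotency_order phi U m].

Definition X1 phi : set {linear V -> V} :=
  [set psi | phi \o psi \o phi =1 phi].

Definition X12 phi : set {linear V -> V} :=
  [set psi | phi \o psi \o phi =1 phi /\ psi \o phi \o psi =1 psi].

Definition XGD phi : set {linear V -> V} :=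
  [set g | phi \o g \o phi =1 phi
           /\ g \o iter (fp_index phi) phi =1 iter (fp_index phi) phi \o g].

Definition is_1GD_inverse phi psi : Prop :=
  exists phi1 phiGD : {linear V -> V},
    [/\ X1 phi phi1, XGD phi phiGD,
        psi \o phi \o psi =1 psi,
        psi \o phi =1 phi1 \o phi
      & phi \o psi =1 phi \o phiGD].

End Definitions.

Section WellDefined.
Variables (k : fieldType) (V : lmodType k).
Implicit Types (phi : {linear V -> V}) (W U : set V).

Lemma iter_is_linear phi n a x y :
  iter n phi (a *: x + y) = a *: iter n phi x + iter n phi y.
Proof. by elim: n => //= n ->; rewrite linearP. Qed.

Lemma iter_lin0 phi n : iter n phi 0 = 0.
Proof. by elim: n => //= n ->; rewrite linear0. Qed.

Lemma iter_linD phi n x y : iter n phi (x + y) = iter n phi x + iter n phi y.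
Proof. by have := iter_is_linear phi n 1 x y; rewrite !scale1r. Qed.

Lemma iter_linB phi n x y : iter n phi (x - y) = iter n phi x - iter n phi y.
Proof.
have := iter_is_linear phi n (-1) y x.
by rewrite !scaleN1r addrC => ->; rewrite addrC.
Qed.

Lemma AST_rangeE phi W U N : AST_decomposition phi W U ->
    vanishes_on (iter N phi) U ->
  W = range (iter N phi) /\ U = [set v | iter N phi v = 0].
Proof.
move=> [[_ Winv] _ [WU dec] [_ [_ Winj Wsurj]] _] U0.
have surjN n w : W w -> exists2 w', W w' & iter n phi w' = w.
  elim: n w => [|n IHn] w Ww; first by exists w.
  have [w1 Ww1 <-] := Wsurj _ Ww; have [w2 Ww2 <-] := IHn _ Ww1.
  by exists w2.
have stab n w : W w -> W (iter n phi w).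
  by elim: n w => //= n IHn w /IHn Ww; apply: Winv; exists (iter n phi w).
have W0 : W 0 by have [] : (W `&` U) 0 by rewrite WU.
have kerW n w : W w -> iter n phi w = 0 -> w = 0.
  elim: n w => //= n IHn w Ww h; apply: IHn => //.
  by apply: Winj; rewrite ?inE ?linear0 //; apply: stab.
split; apply/seteqP; split => v /=.
- by move=> /(surjN N) [w _ <-]; exists w.
- move=> [x _ <-]; have [w [u [Ww Uu ->]]] := dec x.
  by rewrite iter_linD (U0 _ Uu) addr0; apply: stab.
- exact: U0.
- have [w [u [Ww Uu ->]]] := dec v.
  rewrite iter_linD (U0 _ Uu) addr0 => /(kerW _ _ Ww) ->.
  by rewrite add0r.
Qed.

Lemma AST_unique phi W U W' U' :
  AST_decomposition phi W U -> AST_decomposition phi W' U' ->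
  W = W' /\ U = U'.
Proof.
move=> D D'; have [_ _ _ _ [n nU]] := D; have [_ _ _ _ [n' nU']] := D'.
have E : vanishes_on (iter (n' + n) phi) U.
  by move=> v Uv; rewrite iterD nU // iter_lin0.
have E' : vanishes_on (iter (n' + n) phi) U'.
  by move=> v Uv; rewrite addnC iterD nU' // iter_lin0.
by have [-> ->] := AST_rangeE D E; have [-> ->] := AST_rangeE D' E'.
Qed.

Lemma lspan_drop r (e : 'I_r -> V) (c : 'rV[k]_r) :
    \sum_i c 0 i *: e i = 0 -> c != 0 ->
  exists2 r', (r' < r)%N & exists e' : 'I_r' -> V, lspan e = lspan e'.
Proof.
move=> c0 /rV0Pn [i ci].
case: r e c i c0 ci => [|r] e c i c0 ci; first by case: i ci.
exists r => //; exists (e \o lift i).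
have ei : e i = \sum_j (- (c 0 i)^-1 * c 0 (lift i j)) *: e (lift i j).
  apply: (scalerI ci); rewrite scaler_sumr.
  under eq_bigr do rewrite scalerA mulrA mulrN divff // mulN1r scaleNr.
  rewrite sumrN; apply/eqP; rewrite -addr_eq0; apply/eqP; rewrite -[RHS]c0.
  by rewrite (bigD1_ord i).
apply/seteqP; split => v [d ->].
- exists (\row_j (d 0 (lift i j) + d 0 i * (- (c 0 i)^-1 * c 0 (lift i j)))).
  rewrite (bigD1_ord i) //= ei scaler_sumr -big_split /=.
  by apply: eq_bigr => j _; rewrite mxE scalerDl scalerA addrC.
- exists (\row_j (if unlift i j is Some j' then d 0 j' else 0)).
  rewrite [RHS](bigD1_ord i) //= mxE unlift_none scale0r add0r.
  by apply: eq_bigr => j _; rewrite mxE liftK.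
Qed.

Lemma AST_exists phi : finite_potent phi ->
  exists W U, AST_decomposition phi W U.
Proof.
move=> [n0 _ [r0 [e0 R0]]].
pose P r := `[< exists n (e : 'I_r -> V), range (iter n phi) = lspan e >].
have exP : exists r, P r by exists r0; apply/asboolP; exists n0, e0.
case: (ex_minnP exP) => r /asboolP [n [e R]] rmin {n0 r0 e0 R0 exP}.
have free n' (e' : 'I_r -> V) (c : 'rV_r) : range (iter n' phi) = lspan e' ->
    \sum_i c 0 i *: e' i = 0 -> c = 0.
  move=> R' c0; apply/eqP/negPn/negP => /(lspan_drop c0) [r' rr' [e1 E]].
  have /rmin : P r' by apply/asboolP; exists n', e1; rewrite R' E.
  by rewrite leqNgt rr'.
pose comb (c : 'rV[k]_r) := \sum_i c 0 i *: e i.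
have phi_comb c : phi (comb c) = \sum_i c 0 i *: phi (e i).
  by rewrite linear_sum; apply: eq_bigr => i _; rewrite linearZ.
have Rn c : range (iter n phi) (comb c) by rewrite R; exists c.
have R1 : range (iter n.+1 phi) = lspan (phi \o e).
  apply/seteqP; split => v /=.
    move=> [x _ <-].
    have /= [c ->] : lspan e (iter n phi x) by rewrite -R; exists x.
    by exists c; rewrite phi_comb.
  move=> [c ->]; have [x _ xc] := Rn c.
  by exists x => //=; rewrite xc phi_comb.
have W_inv v : range (iter n phi) v -> range (iter n phi) (phi v).
  by move=> [x _ <-]; exists (phi x) => //; rewrite -iterS iterSr.
have phi_inj v : range (iter n phi) v -> phi v = 0 -> v = 0.
  rewrite R => -[c ->]; rewrite phi_comb => /(free _ _ _ R1) ->.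
  by apply: big1 => i _; rewrite mxE scale0r.
have /choice [A AE] i : exists a : 'rV_r, phi (e i) = comb a.
  have /W_inv : range (iter n phi) (e i).
    rewrite R; exists (delta_mx 0 i).
    rewrite (bigD1 i) //= mxE !eqxx scale1r big1 ?addr0 // => j ji.
    by rewrite mxE (negbTE ji) andbF scale0r.
  by rewrite R => -[a ->]; exists a.
pose M := \matrix_i A i.
have phiM c : phi (comb c) = comb (c *m M).
  rewrite phi_comb; under eq_bigr do rewrite AE scaler_sumr.
  rewrite exchange_big; apply: eq_bigr => j _; rewrite mxE scaler_suml.
  by apply: eq_bigr => i _; rewrite scalerA mxE.
have unitM : M \in unitmx.
  rewrite -row_free_unit -kermx_eq0; apply/eqP/row_matrixP => i.
  rewrite row0; apply: (free _ _ _ R1).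
  rewrite -phi_comb phiM -row_mul mulmx_ker row0.
  by apply: big1 => j _; rewrite mxE scale0r.
have phi_surj v : range (iter n phi) v ->
    exists2 w, range (iter n phi) w & phi w = v.
  rewrite {1}R => -[c ->]; exists (comb (c *m invmx M)); first exact: Rn.
  by rewrite phiM mulmxKV.
have W_D a u v : range (iter n phi) u -> range (iter n phi) v ->
    range (iter n phi) (a *: u + v).
  move=> [x _ <-] [y _ <-].
  by exists (a *: x + y) => //; rewrite iter_is_linear.
have W_0 : range (iter n phi) 0 by exists 0 => //; rewrite iter_lin0.
have injN m v : range (iter n phi) v -> iter m phi v = 0 -> v = 0.
  elim: m v => //= m IHm v Wv; rewrite -iterS iterSr => h.
  by apply: phi_inj => //; apply: IHm h; apply: W_inv.
have surjN m v : range (iter n phi) v ->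
    exists2 w, range (iter n phi) w & iter m phi w = v.
  elim: m v => [|m IHm] v Wv; first by exists v.
  have [w Ww <-] := phi_surj _ Wv; have [w' Ww' <-] := IHm _ Ww.
  by exists w'.
exists (range (iter n phi)), [set v | iter n phi v = 0]; split.
- split; last by move=> _ [v Wv <-]; apply: W_inv.
  by split=> [|a u v]; rewrite ?inE //; apply: W_D.
- split; last by move=> _ [v /= Uv <-] /=; rewrite -iterSr iterS Uv linear0.
  split=> [|a u v]; rewrite ?inE /= ?iter_lin0 // => Uu Uv.
  by rewrite iter_is_linear Uu Uv scaler0 addr0.
- split.
    apply/seteqP; split => v /=; first by move=> [Wv /(injN _ _ Wv)].
    by move=> ->; split=> //; rewrite iter_lin0.
  move=> v; have [//|w Ww wv] := @surjN n (iter n phi v).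
  exists w, (v - w); split=> //=; last by rewrite addrC subrK.
  by rewrite iter_linB wv subrr.
- split; first by exists r, e.
  split.
  + by move=> v; apply: W_inv.
  + move=> u v; rewrite !inE => Wu Wv uv; apply/eqP; rewrite -subr_eq0.
    apply/eqP/phi_inj; last by rewrite linearB uv subrr.
    by rewrite addrC -scaleN1r; apply: W_D.
  + by move=> v /phi_surj [w Ww <-]; exists w.
- by exists n.
Qed.

Lemma fp_indexP phi W U : AST_decomposition phi W U ->
  nilpotency_order phi U (fp_index phi).
Proof.
move=> D; have [_ _ _ _ [n nU]] := D.
have exn : exists m, `[< vanishes_on (iter m phi) U >].
  by exists n; apply/asboolP.
have [m /asboolP mU mmin] := ex_minnP exn.
rewrite /fp_index; case: xgetP => [p _ [W' [U' [D']]]|/(_ m) []].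
  by have [_ <-] := AST_unique D D'.
by exists W, U; split=> //; split=> // j jU; apply: mmin; apply/asboolP.
Qed.

End WellDefined.

(* Main.v *)
Require Import Defs.
From HB Require Import structures.
From mathcomp Require Import all_boot all_order all_algebra.
From mathcomp Require Import boolp classical_sets functions.
Local Open Scope classical_set_scope.
Local Open Scope ring_scope.

(** Put [m = i(phi)], so that [U = ker phi^m].  If [psi] is a 1GD inverse coming
    from [g], then [phi^m psi = phi^m g = g phi^m] when [m > 0], hence [psi]
    preserves [U].  Conversely, let [psi] be a reflexive inverse preserving [U],
    and let [g] be [(phi|W)^-1] on [W] and [psi] on [U].  Since
    [phi psi phi = phi], the map [phi psi] is the identity on [W = phi W], so
    [phi g = phi psi]; and [g] commutes with [phi^m], which kills [U].  Thus
    [psi] and [g] witness that [psi] is a 1GD inverse. *)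

Import GRing.Theory.

(** Subtracting two pairs over the same [v] gives a pair over [0], so the condition at [0] makes [G]
    single-valued. This defines a map on a direct sum without naming projections. *)
Lemma linear_of_graph (k : fieldType) (V1 V2 : lmodType k)
    (G : V1 -> V2 -> Prop) :
    (forall v, exists x, G v x) -> (forall x, G 0 x -> x = 0) ->
    (forall a v x w y, G v x -> G w y -> G (a *: v + w) (a *: x + y)) ->
  exists g : {linear V1 -> V2}, forall v x, G v x -> g v = x.
Proof.
move=> Gtot G0 Glin.
have Gfun v x y : G v x -> G v y -> x = y.
  move=> Gx Gy; apply/eqP; rewrite -subr_eq0; apply/eqP/G0.
  by have := Glin (-1) _ _ _ _ Gy Gx; rewrite !scaleN1r !addNr addrC.
have [f Gf] := choice Gtot.
have f_lin : linear f.
  by move=> a v w; apply: Gfun (Gf _) _; apply: Glin.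
pose fL := GRing.isLinear.Build _ _ _ _ f f_lin.
pose g : {linear V1 -> V2} := HB.pack f fL.
by exists g => v x; apply: Gfun (Gf v).
Qed.

Section FinitePotent.
Variables (k : fieldType) (V : lmodType k).
Variables (phi : {linear V -> V}) (W U : set V).
Hypothesis D : AST_decomposition phi W U.

Lemma one_GD_inverse_stable (psi : {linear V -> V}) :
  is_1GD_inverse phi psi -> psi @` U `<=` U.
Proof.
have [mU _] := fp_indexP D; have [_ UE] := AST_rangeE D mU.
move=> [phi1 [g [_ [_ gC] _ _ psig]]] _ [u Uu <-].
have {}gC v : g (iter (fp_index phi) phi v) = iter (fp_index phi) phi (g v).
  exact: gC.
(* At index [0] the iterate is the identity, so [u = 0]. Otherwise one [phi] can be split off to
   meet [psi u], where [phi psi = phi g] applies. *)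
move: Uu; rewrite UE /=; case: (fp_index phi) gC => [|m] gC Uu.
  by rewrite /= in Uu *; rewrite Uu linear0.
have phi_psi : phi (psi u) = phi (g u) by exact: psig.
by rewrite iterSr phi_psi -iterSr -gC Uu linear0.
Qed.

(** Since [phi] maps [W] bijectively to itself, writing the [W]-component as [phi w] avoids naming
    the inverse of the restriction. *)
Lemma stable_gluing (psi : {linear V -> V}) : psi @` U `<=` U ->
  exists g : {linear V -> V},
    forall w u, W w -> U u -> g (phi w + u) = w + psi u.
Proof.
move=> psiU.
have [[[W0 WL] Winv] [[U0 UL] _] [WU dec] [_ [_ Winj Wsurj]] _] := D.
have {}WL a x y : W x -> W y -> W (a *: x + y).
  by move=> Wx Wy; have := WL a x y; rewrite !inE; apply.
have {}UL a x y : U x -> U y -> U (a *: x + y).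
  by move=> Ux Uy; have := UL a x y; rewrite !inE; apply.
have {}W0 : W 0 by rewrite inE in W0.
have {}U0 : U 0 by rewrite inE in U0.
pose G v x := exists w u, [/\ W w, U u, v = phi w + u & x = w + psi u].
have [||a v x v' y|g gP] := @linear_of_graph k V V G.
- move=> v; have [w [u [Ww Uu ->]]] := dec v.
  by have [w' Ww' <-] := Wsurj _ Ww; exists (w' + psi u), w', u.
- move=> _ [w [u [Ww Uu /esym/eqP e ->]]].
  (* From [phi w + u = 0], [u = - phi w] lies in both [W] and [U]. *)
  have u0 : u = 0.
    have : (W `&` U) u.
      split=> //; move: e; rewrite addr_eq0 => /eqP e.
      rewrite -[u]opprK -e -scaleN1r -[_ *: _]addr0.
      by apply: WL => //; apply: Winv; exists w.
    by rewrite WU.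
  move: e; rewrite u0 linear0 !addr0 => /eqP e.
  by apply: Winj; rewrite ?inE ?linear0.
- move=> [w [u [Ww Uu -> ->]]] [w' [u' [Ww' Uu' -> ->]]].
  exists (a *: w + w'), (a *: u + u'); split; [exact: WL|exact: UL| |];
  by rewrite !linearP scalerDr addrACA.
- by exists g => w u Ww Uu; apply: gP; exists w, u.
Qed.

Lemma stable_inverse_GD (psi : {linear V -> V}) :
    X1 phi psi -> psi @` U `<=` U ->
  exists2 g : {linear V -> V}, XGD phi g & phi \o psi =1 phi \o g.
Proof.
move=> psi1 psiU; have [g gE] := stable_gluing psi psiU.
have [mU _] := fp_indexP D.
have [[_ Winv] _ [_ dec] [_ [_ _ Wsurj]] _] := D.
have decW v : exists w u, [/\ W w, U u & v = phi w + u].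
  have [w [u [Ww Uu ->]]] := dec v.
  by have [w' Ww' <-] := Wsurj _ Ww; exists w', u.
have phi_psi v : phi (psi v) = phi (g v).
  have [w [u [Ww Uu ->]]] := decW v.
  have psi1w : phi (psi (phi w)) = phi w by exact: psi1.
  by rewrite gE // !linearD psi1w.
exists g => //; split=> v /=.
  by rewrite -phi_psi; apply: psi1.
have [w [u [Ww Uu ->]]] := decW v; rewrite gE // !iter_linD.
have Ww' n : W (iter n phi w).
  by elim: n => [|n IHn] //=; apply: Winv; exists (iter n phi w).
have U0 : U 0.
  by have [_ [[U0 _] _] _ _ _] := D; rewrite inE in U0.
have Upsi : U (psi u) by apply: psiU; exists u.
rewrite (mU u) // (mU (psi u)) //.
(* Moving one [phi] outermost gives [phi w' + 0] with [w' = iter m phi w] in [W], where [m] is the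
   index; [gE] with [u = 0] returns [w']. *)
by rewrite -iterSr iterS gE // linear0 addr0.
Qed.

End FinitePotent.

Theorem theorem3p22 (k : fieldType) (V : lmodType k)
    (phi : {linear V -> V}) (W U : set V) :
  finite_potent phi ->
  AST_decomposition phi W U ->
  forall psi : {linear V -> V},
    is_1GD_inverse phi psi <-> (X12 phi psi /\ psi @` U `<=` U).
Proof.
move=> _ D psi; split=> [psiGD|[[psi1 psi2] psiU]].
  split; last exact: one_GD_inverse_stable D _ psiGD.
  have [phi1 [g [phi11 _ psi2 psi_phi _]]] := psiGD.
  (* Here [phi psi phi = phi phi1 phi = phi]. *)
  split=> // v; have /= -> := psi_phi v; exact: phi11.
have [g gGD phi_psi] := stable_inverse_GD _ _ _ _ _ D psi psi1 psiU.
by exists psi, g; split.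
Qed.
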